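(* Let $M^\star\in\mathbb{R}^{m\times n}$, $k=\min(m,n)$, with singular value decomposition $M^\star=P\Sigma Q^\top$, $\Sigma=\mathrm{diag}(\sigma_1,\dots,\sigma_k)$, $\sigma_1>\sigma_2>\cdots>\sigma_k>0$. Let $W^\star$ be the unique minimizer over $W\in\mathbb{R}^{m\times n}$ of $$\Phi(W)=\frac14\|W-2M^\star\|_F^2+\frac1{4k}\|W\|_\star^2.$$ Then $W^\star=M^\star$ if and only if $\sigma_1=\sigma_2=\cdots=\sigma_k$. Consequently, under the assumption $\sigma_1>\cdots>\sigma_k$, every global minimizer $(U,V)\in\mathbb{R}^{m\times k}\times\mathbb{R}^{n\times k}$ of $$\frac{1}{2^k-1}\sum_{\emptyset\ne S\subseteq\{1,\dots,k\}}\|U\Pi_SV^\top-M^\star\|_F^2$$ satisfies $\|UV^\top-M^\star\|_F^2=\|W^\star-M^\star\|_F^2>0$.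
   Context: $\|\cdot\|_F$ is the Frobenius norm and $\|\cdot\|_\star$ the nuclear norm (sum of singular values). For $S\subseteq\{1,\dots,k\}$, $\Pi_S$ is the $k\times k$ diagonal matrix with $(\Pi_S)_{ii}=1$ if $i\in S$ and $0$ otherwise.
   Formalization: The consequence about global minimizers (U,V) is stated for k ≥ 2: for k = 1 the chain σ_1>…>σ_k is vacuous, W* = M*, and the strict inequality ‖W*−M*‖_F² > 0 fails. *)

(* Defs.v *)
From HB Require Import structures.
From mathcomp Require Import all_boot all_order all_algebra.
From mathcomp Require Import reals.
From Stdlib Require Import ClassicalEpsilon.
Set Implicit Arguments. Unset Strict Implicit. Unset Printing Implicit Defensive.
Import Order.TTheory GRing.Theory Num.Theory.
Local Open Scope ring_scope.

Section Defs.
Variable R : realType.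

Definition frob2 {m n : nat} (A : 'M[R]_(m, n)) : R :=
  \sum_(i < m) \sum_(j < n) A i j ^+ 2.

Definition is_svd {m n : nat} (W : 'M[R]_(m, n)) (s : 'rV[R]_(minn m n)) : Prop :=
  exists (P : 'M[R]_(m, minn m n)) (Q : 'M[R]_(n, minn m n)),
    P^T *m P = 1%:M /\ Q^T *m Q = 1%:M /\ (forall i, 0 <= s 0 i) /\
    W = P *m diag_mx s *m Q^T.

Definition svals {m n : nat} (W : 'M[R]_(m, n)) : 'rV[R]_(minn m n) :=
  epsilon (inhabits 0) (is_svd W).

Definition nucnorm {m n : nat} (W : 'M[R]_(m, n)) : R :=
  \sum_(i < minn m n) svals W 0 i.

Definition Phi {m n : nat} (M W : 'M[R]_(m, n)) : R :=
  frob2 (W - 2%:R *: M) / 4%:R + nucnorm W ^+ 2 / (4 * (minn m n)%:R).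

Definition PiS {k : nat} (S : {set 'I_k}) : 'M[R]_k :=
  diag_mx (\row_i (if i \in S then 1 else 0)).

Definition Lk {m n : nat} (M : 'M[R]_(m, n))
  (U : 'M[R]_(m, minn m n)) (V : 'M[R]_(n, minn m n)) : R :=
  (\sum_(S : {set 'I_(minn m n)} | S != set0)
      frob2 (U *m PiS S *m V^T - M)) / (2 ^+ (minn m n) - 1).

End Defs.

(* Main.v *)
Require Import Defs.
From HB Require Import structures.
From mathcomp Require Import all_boot all_order all_algebra.
From mathcomp Require Import reals.
From mathcomp Require Import complex ring lra.
From Stdlib Require Import ClassicalEpsilon.
Set Implicit Arguments. Unset Strict Implicit. Unset Printing Implicit Defensive.
Import Order.TTheory GRing.Theory Num.Theory.
Local Open Scope ring_scope.

(* Every real matrix has an SVD, and the nuclear norm is the maximum of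
   tr (P^T W Q) over P, Q with orthonormal columns; hence it is convex, equals
   the sum of singular values of any SVD, and Phi has at most one minimizer.
   Averaging over S is taking Bernoulli(1/2) columns, so up to an affine change
   the loss is |UV^T - 2M|^2 / 4 + (sum_i |u_i|^2 |v_i|^2) / 4. Its last term is
   at least |UV^T|_*^2 / (4k), with equality for a suitable factorization of any
   W, since some rotation equalizes the diagonal of the matrix of singular
   values. Hence minimizers of the loss satisfy UV^T = W*. Finally M minimizes
   Phi only if its singular values agree: otherwise moving mass from a smaller
   to a larger one decreases Phi. *)

(** * Frobenius norm *)

Lemma frob2E (R : realType) m n (A : 'M[R]_(m, n)) : frob2 A = \tr (A *m A^T).
Proof.
rewrite /frob2 /mxtrace; apply: eq_bigr => i _; rewrite mxE.
by apply: eq_bigr => j _; rewrite mxE expr2.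
Qed.

Lemma frob2_ge0 (R : realType) m n (A : 'M[R]_(m, n)) : 0 <= frob2 A.
Proof. by apply: sumr_ge0 => i _; apply: sumr_ge0 => j _; exact: sqr_ge0. Qed.

Lemma frob2_eq0 (R : realType) m n (A : 'M[R]_(m, n)) :
  (frob2 A == 0) = (A == 0).
Proof.
apply/eqP/eqP => [|->]; last first.
  by rewrite frob2E mul0mx mxtrace0.
move=> /eqP; rewrite psumr_eq0; last first.
  by move=> i _; apply: sumr_ge0 => j _; exact: sqr_ge0.
move=> /allP h; apply/matrixP => i j; rewrite mxE.
have := h i (mem_index_enum i); rewrite /= psumr_eq0; last first.
  by move=> ? _; exact: sqr_ge0.
by move=> /allP/(_ j (mem_index_enum j)) /=; rewrite sqrf_eq0 => /eqP.
Qed.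

Lemma frob2_gt0 (R : realType) m n (A : 'M[R]_(m, n)) :
  (0 < frob2 A) = (A != 0).
Proof. by rewrite lt_def frob2_ge0 andbT frob2_eq0. Qed.

Lemma frob2_tr (R : realType) m n (A : 'M[R]_(m, n)) : frob2 A^T = frob2 A.
Proof. by rewrite !frob2E trmxK mxtrace_mulC. Qed.

Lemma frob2Z (R : realType) m n c (A : 'M[R]_(m, n)) :
  frob2 (c *: A) = c ^+ 2 * frob2 A.
Proof.
rewrite !frob2E linearZ /= -scalemxAl -scalemxAr scalerA mxtraceZ expr2 //.
Qed.

Lemma mxtrace_mul_trC (R : realType) m n (A B : 'M[R]_(m, n)) :
  \tr (A *m B^T) = \tr (B *m A^T).
Proof. by rewrite -mxtrace_tr trmx_mul trmxK. Qed.

Lemma frob2B (R : realType) m n (A B : 'M[R]_(m, n)) :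
  frob2 (A - B) = frob2 A - 2 * \tr (A *m B^T) + frob2 B.
Proof.
rewrite !frob2E linearB /= mulmxBl !mulmxBr !linearB /=.
by rewrite (mxtrace_mul_trC B A); ring.
Qed.

Lemma mul_row_tr (R : realType) n (v : 'rV[R]_n) : v *m v^T = (frob2 v)%:M.
Proof. by rewrite frob2E [LHS]mx11_scalar trace_mx11. Qed.

Lemma mul_tr_col (R : realType) n (v : 'cV[R]_n) : v^T *m v = (frob2 v)%:M.
Proof. by rewrite -[X in _ *m X]trmxK mul_row_tr frob2_tr. Qed.

(** * Singular value decomposition *)

(* Write a complex eigenvector of A on the row space of B as y + iz; symmetry
   of A makes the imaginary part of the eigenvalue kill |y|^2 + |z|^2. *)
Lemma sym_stable_eigenvector (R : realType) r n (A : 'M[R]_n)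
    (B : 'M[R]_(r, n)) :
  (0 < r)%N -> A^T = A -> row_free B -> (B *m A <= B)%MS ->
  exists a (v : 'rV[R]_n), [/\ v != 0, (v <= B)%MS & v *m A = a *: v].
Proof.
move=> r0 symA freeB /submxP[C BAC].
have /closed_rootP[[a b]] : size (char_poly (map_mx (real_complex R) C)) != 1%N.
  by rewrite size_char_poly eqSS -lt0n.
rewrite -eigenvalue_root_char => /eigenvalueP[x xC x0].
pose y := map_mx (@complex.Re R) x; pose z := map_mx (@complex.Im R) x.
have ReD : {morph @complex.Re R : u v / u + v} by move=> [? ?] [? ?].
have ImD : {morph @complex.Im R : u v / u + v} by move=> [? ?] [? ?].
have yC : y *m C = a *: y - b *: z.
  apply/matrixP => i j; have /matrixP/(_ i j) := xC.
  rewrite !mxE => /(congr1 (@complex.Re R)).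
  rewrite (big_morph (@complex.Re R) ReD (erefl : complex.Re 0 = 0)) => e.
  transitivity (complex.Re ((a +i* b)%C * x i j)); last by case: (x i j).
  rewrite -e; apply: eq_bigr => k _; rewrite !mxE.
  by case: (x i k) => u v /=; rewrite mulr0 subr0.
have zC : z *m C = a *: z + b *: y.
  apply/matrixP => i j; have /matrixP/(_ i j) := xC.
  rewrite !mxE => /(congr1 (@complex.Im R)).
  rewrite (big_morph (@complex.Im R) ImD (erefl : complex.Im 0 = 0)) => e.
  transitivity (complex.Im ((a +i* b)%C * x i j)); last by case: (x i j).
  rewrite -e; apply: eq_bigr => k _; rewrite !mxE.
  by case: (x i k) => u v /=; rewrite mulr0 add0r.
have yBA : (y *m B) *m A = a *: (y *m B) - b *: (z *m B).
  by rewrite -mulmxA BAC mulmxA yC mulmxBl -!scalemxAl.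
have zBA : (z *m B) *m A = a *: (z *m B) + b *: (y *m B).
  by rewrite -mulmxA BAC mulmxA zC mulmxDl -!scalemxAl.
have yz0 : (y != 0) || (z != 0).
  apply: contraNT x0; rewrite negb_or !negbK => /andP[/eqP y0 /eqP z0].
  apply/eqP/matrixP => i j.
  move/matrixP: y0 => /(_ i j); move/matrixP: z0 => /(_ i j).
  by rewrite !mxE; case: (x i j) => u v /= -> ->.
have nzB (t : 'rV[R]_r) : t != 0 -> t *m B != 0.
  apply: contraNneq => tB; have /row_freeP[D BD] := freeB.
  by rewrite -[t]mulmx1 -BD mulmxA tB mul0mx.
have b0 : b = 0.
  have h : \tr (y *m B *m A *m (z *m B)^T) = \tr (z *m B *m A *m (y *m B)^T).
    by rewrite -mxtrace_tr !trmx_mul !trmxK symA !mulmxA.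
  move: h; rewrite yBA zBA mulmxBl mulmxDl -!scalemxAl linearB linearD /=.
  rewrite !mxtraceZ -!frob2E.
  have -> : \tr (z *m B *m (y *m B)^T) = \tr (y *m B *m (z *m B)^T).
    by rewrite -mxtrace_tr !trmx_mul !trmxK !mulmxA.
  move=> h; have /eqP : b * (frob2 (y *m B) + frob2 (z *m B)) = 0 by lra.
  rewrite mulf_eq0 => /orP[/eqP //|].
  rewrite paddr_eq0 ?frob2_ge0 // !frob2_eq0 => /andP[/eqP h1 /eqP h2].
  by case/orP: yz0 => /nzB; rewrite (h1, h2) eqxx.
case/orP: yz0 => /nzB nz; exists a.
  by exists (y *m B); split; rewrite ?submxMl // yBA b0 scale0r subr0.
by exists (z *m B); split; rewrite ?submxMl // zBA b0 scale0r addr0.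
Qed.

Lemma normalize_row (R : realType) n (v : 'rV[R]_n) :
  v != 0 -> exists2 c : R, c != 0 & frob2 (c *: v) = 1.
Proof.
rewrite -frob2_gt0 => v0; exists (Num.sqrt (frob2 v))^-1.
  by rewrite invr_eq0 sqrtr_eq0 -ltNge.
by rewrite frob2Z exprVn sqr_sqrtr ?ltW // mulVf // gt_eqF.
Qed.

(** An eigenvector of [W^T *m W] serves as [v], and [W *m v], normalized, as [u]. Taking the
    eigenvector in the row space of [W] forces [W *m v] to be nonzero, hence a positive
    eigenvalue. *)
Lemma singular_triple (R : realType) m n (W : 'M[R]_(m, n)) : W != 0 ->
  exists (a : R) (u : 'cV[R]_m) (v : 'cV[R]_n),
    [/\ 0 < a, u^T *m u = 1%:M, v^T *m v = 1%:M,
        W *m v = a *: u & u^T *m W = a *: v^T].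
Proof.
move=> W0; pose B := row_base W.
have BW : (B :=: W)%MS by exact: eq_row_base.
have [||||a [w [w0 wB wA]]] :=
    @sym_stable_eigenvector _ _ _ (W^T *m W) B.
- by rewrite lt0n mxrank_eq0.
- by rewrite trmx_mul trmxK.
- exact: row_base_free.
- by rewrite BW mulmxA submxMl.
have [c c0 nv] := normalize_row w0.
set v := c *: w in nv.
have vA : v *m (W^T *m W) = a *: v.
  by rewrite /v -scalemxAl wA !scalerA mulrC.
have /submxP[t vt] : (v <= W)%MS by rewrite -BW scalemx_sub.
have na : frob2 (W *m v^T) = a.
  rewrite -frob2_tr frob2E trmxK trmx_mul trmxK -mulmxA.
  by rewrite [W^T *m _]mulmxA mulmxA vA -scalemxAl mxtraceZ -frob2E nv mulr1.
have a0 : 0 < a.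
  rewrite -na frob2_gt0; apply/eqP => Wv.
  have : frob2 v = 0 by rewrite frob2E {1}vt -mulmxA Wv mulmx0 mxtrace0.
  by rewrite nv => /eqP; rewrite oner_eq0.
have s0 : 0 < Num.sqrt a by rewrite sqrtr_gt0.
have ss : Num.sqrt a * Num.sqrt a = a by rewrite -expr2 sqr_sqrtr // ltW.
exists (Num.sqrt a), ((Num.sqrt a)^-1 *: (W *m v^T)), v^T; split => //.
- rewrite mul_tr_col frob2Z na exprVn sqr_sqrtr ?mulVf ?gt_eqF ?ltW //.
- by rewrite mul_tr_col frob2_tr nv.
- by rewrite scalerA mulfV ?gt_eqF // scale1r.
- rewrite linearZ /= trmx_mul !trmxK -scalemxAl -mulmxA vA scalerA.
  by rewrite -{2}ss mulKf // gt_eqF.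
Qed.

Lemma orthonormal_extension (R : realType) m j (P : 'M[R]_(m, j)) :
  (j < m)%N -> exists u : 'cV[R]_m, u^T *m u = 1%:M /\ P^T *m u = 0.
Proof.
move=> jm; have /rowV0Pn[w wk w0] : kermx P != 0.
  rewrite -mxrank_eq0 mxrank_ker -lt0n subn_gt0.
  exact: leq_ltn_trans (rank_leq_col _) jm.
have [c c0 nw] := normalize_row w0.
exists (c *: w)^T; split; first by rewrite mul_tr_col frob2_tr nw.
by apply: trmx_inj; rewrite trmx_mul !trmxK trmx0 -scalemxAl (sub_kermxP wk) scaler0.
Qed.

(** The dimensions are linked by an equation because [k] will be [minn m n], which is only provably
    equal to the other dimension. *)
Lemma orthonormal_square (R : realType) k m (P : 'M[R]_(m, k)) :
  k = m -> P^T *m P = 1%:M -> P *m P^T = 1%:M.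
Proof. by move=> e; case: m / e P => P /mulmx1C. Qed.

Lemma orthonormal_row_mx (R : realType) m j (u : 'cV[R]_m) (P : 'M[R]_(m, j)) :
  u^T *m u = 1%:M -> P^T *m P = 1%:M -> P^T *m u = 0 ->
  (row_mx u P)^T *m row_mx u P = 1%:M.
Proof.
move=> uu PP Pu; rewrite tr_row_mx mul_col_row uu PP Pu.
have -> : u^T *m P = 0 by apply: trmx_inj; rewrite trmx_mul trmxK Pu trmx0.
by rewrite -scalar_mx_block.
Qed.

Lemma svd_row_mx (R : realType) m n j (u : 'cV[R]_m) (v : 'cV[R]_n) (a : R)
    (P : 'M[R]_(m, j)) (Q : 'M[R]_(n, j)) (s : 'rV[R]_j) :
  row_mx u P *m diag_mx (row_mx a%:M s) *m (row_mx v Q)^T =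
  a *: (u *m v^T) + P *m diag_mx s *m Q^T.
Proof.
rewrite diag_mx_row mul_row_block !mulmx0 addr0 add0r tr_row_mx mul_row_col.
have -> : u *m diag_mx a%:M = a *: u.
  by apply/matrixP => i l; rewrite mul_mx_diag !mxE ord1 eqxx mulr1n mulrC.
by rewrite -scalemxAl.
Qed.

(** Induction on the number of singular triples split off. Since [P^T] and [Q] annihilate the
    remainder [E], singular vectors of [E] with nonzero value are orthogonal to those already
    found. *)
Lemma partial_svd (R : realType) m n (W : 'M[R]_(m, n)) j :
  (j <= minn m n)%N ->
  exists (P : 'M[R]_(m, j)) (Q : 'M[R]_(n, j)) (s : 'rV[R]_j) (E : 'M[R]_(m, n)),
    [/\ P^T *m P = 1%:M, Q^T *m Q = 1%:M, forall i, 0 <= s 0 i,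
        W = P *m diag_mx s *m Q^T + E & P^T *m E = 0 /\ E *m Q = 0].
Proof.
elim: j => [_|j IH jmn].
  exists 0, 0, 0, W; split; last by split; [exact: flatmx0|exact: thinmx0].
  - by apply/matrixP => -[].
  - by apply/matrixP => -[].
  - by case.
  - by rewrite !mul0mx add0r.
have [P [Q [s [E [PP QQ s0 WE [PE EQ]]]]]] := IH (ltnW jmn).
have [jm jn] : (j < m)%N /\ (j < n)%N by apply/andP; rewrite -leq_min.
have [a [u [v [a0 uu vv [Pu Qv] [Ev uE]]]]] :
    exists (a : R) (u : 'cV[R]_m) (v : 'cV[R]_n),
    [/\ 0 <= a, u^T *m u = 1%:M, v^T *m v = 1%:M,
        P^T *m u = 0 /\ Q^T *m v = 0 &
        E *m v = a *: u /\ u^T *m E = a *: v^T].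
  (* A zero remainder has no singular triple; unit vectors orthogonal to the previous columns are
     then added with singular value 0. *)
  have [E0|E0] := eqVneq E 0.
    have [u [uu Pu]] := orthonormal_extension P jm.
    have [v [vv Qv]] := orthonormal_extension Q jn.
    by exists 0, u, v; split => //; rewrite E0 mul0mx mulmx0 !scale0r.
  have [a [u [v [a0 uu vv Ev uE]]]] := singular_triple E0.
  exists a, u, v; split; rewrite ?ltW //; split.
    have -> : u = a^-1 *: (E *m v) by rewrite Ev scalerA mulVf ?gt_eqF // scale1r.
    by rewrite -scalemxAr mulmxA PE mul0mx scaler0.
  have -> : v = a^-1 *: (u^T *m E)^T.
    by rewrite uE linearZ /= trmxK scalerA mulVf ?gt_eqF // scale1r.
  by rewrite -scalemxAr -trmx_mul -mulmxA EQ mulmx0 trmx0 scaler0.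
pose P' : 'M[R]_(m, j.+1) := row_mx u P.
pose Q' : 'M[R]_(n, j.+1) := row_mx v Q.
pose s' : 'rV[R]_j.+1 := row_mx a%:M s.
exists P', Q', s', (E - a *: (u *m v^T)); split.
- exact: orthonormal_row_mx.
- exact: orthonormal_row_mx.
- move=> i; rewrite /s' mxE; case: splitP => l _ //.
  by rewrite ord1 mxE eqxx mulr1n.
- by rewrite [_ *m Q'^T]svd_row_mx addrC addrA subrK addrC.
have vQ : v^T *m Q = 0 by apply: trmx_inj; rewrite trmx_mul trmxK Qv trmx0.
have P'E : (row_mx u P)^T *m (E - a *: (u *m v^T)) = 0.
  rewrite tr_row_mx mul_col_mx !mulmxBr uE PE -!scalemxAr !mulmxA uu Pu.
  by rewrite mul1mx mul0mx scaler0 !subrr col_mx0.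
have EQ' : (E - a *: (u *m v^T)) *m row_mx v Q = 0.
  rewrite mul_mx_row !mulmxBl Ev EQ -!scalemxAl -!mulmxA vv vQ.
  by rewrite mulmx1 mulmx0 scaler0 !subrr row_mx0.
by split.
Qed.

(** After [minn m n] steps [P] or [Q] is square, hence orthogonal, and the remainder it annihilates
    is zero. *)
Lemma svd_exists (R : realType) m n (W : 'M[R]_(m, n)) : exists s, is_svd W s.
Proof.
have [P [Q [s [E [PP QQ s0 WE [PE EQ]]]]]] := partial_svd W (leqnn _).
exists s, P, Q; split => //; split => //; split => //.
rewrite {1}WE; suff -> : E = 0 by rewrite addr0.
have [mn|nm] := leqP m n.
  have e : minn m n = m by apply/minn_idPl.
  by rewrite -[E]mul1mx -(orthonormal_square e PP) -mulmxA PE mulmx0.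
have e : minn m n = n by apply/minn_idPr/ltnW.
by rewrite -[E]mulmx1 -(orthonormal_square e QQ) mulmxA EQ mul0mx.
Qed.

(** * Nuclear norm *)

Lemma frob2_parallelogram (R : realType) m n (A B : 'M[R]_(m, n)) :
  frob2 (A + B) + frob2 (A - B) = 2 * frob2 A + 2 * frob2 B.
Proof.
have -> : A + B = A - (-1) *: B by rewrite scaleN1r opprK.
rewrite !frob2B frob2Z linearZ /= -scalemxAr mxtraceZ; ring.
Qed.

Lemma frob2_cauchy_schwarz (R : realType) m n (A B : 'M[R]_(m, n)) :
  \tr (A *m B^T) ^+ 2 <= frob2 A * frob2 B.
Proof.
have [->|B0] := eqVneq B 0.
  by rewrite trmx0 mulmx0 mxtrace0 expr0n /= mulr_ge0 ?frob2_ge0.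
have b0 : 0 < frob2 B by rewrite frob2_gt0.
(* This square expands to [frob2 B] times the gap in the inequality. *)
have := frob2_ge0 (frob2 B *: A - \tr (A *m B^T) *: B).
rewrite frob2B !frob2Z linearZ /= -scalemxAl -scalemxAr !mxtraceZ.
move: (frob2 A) (frob2 B) b0 (\tr _) => a b b0 t h.
have : 0 <= b * (a * b - t ^+ 2) by lra.
by rewrite pmulr_rge0 // subr_ge0.
Qed.

Lemma frob2_orthonormal_mul (R : realType) m n k (P : 'M[R]_(m, k))
    (A : 'M[R]_(k, n)) :
  P^T *m P = 1%:M -> frob2 (P *m A) = frob2 A.
Proof.
by move=> PP; rewrite !frob2E trmx_mul -mulmxA mxtrace_mulC -!mulmxA PP mulmx1.
Qed.

(** Pythagoras: the gap is the squared norm of [A - P *m (P^T *m A)]. *)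
Lemma frob2_orthonormal_tr_mul_le (R : realType) m n k (P : 'M[R]_(m, k))
    (A : 'M[R]_(m, n)) :
  P^T *m P = 1%:M -> frob2 (P^T *m A) <= frob2 A.
Proof.
move=> PP; have := frob2_ge0 (A - P *m (P^T *m A)).
rewrite frob2B frob2_orthonormal_mul // trmx_mul mulmxA mxtrace_mulC mulmxA.
by rewrite -frob2E; lra.
Qed.

Lemma mxtrace_mul_tr_col (R : realType) m k (A B : 'M[R]_(m, k)) :
  \tr (A *m B^T) = \sum_i \tr (col i A *m (col i B)^T).
Proof.
rewrite /mxtrace exchange_big; apply: eq_bigr => p _.
by rewrite mxE; apply: eq_bigr => i _; rewrite !mxE big_ord1 !mxE.
Qed.

(** The trace is a sum of inner products of the columns of [P^T *m U] and [Q^T *m V]; Cauchy-Schwarz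
    applies, and [P^T], [Q^T] are contractions. This single estimate bounds the nuclear norm by any
    factorization and also shows that an SVD maximizes the trace. *)
Lemma mxtrace_factor_le (R : realType) m n k l (P : 'M[R]_(m, k))
    (Q : 'M[R]_(n, k)) (U : 'M[R]_(m, l)) (V : 'M[R]_(n, l)) :
  P^T *m P = 1%:M -> Q^T *m Q = 1%:M ->
  \tr (P^T *m (U *m V^T) *m Q) <=
  \sum_i Num.sqrt (frob2 (col i U)) * Num.sqrt (frob2 (col i V)).
Proof.
move=> PP QQ.
have -> : P^T *m (U *m V^T) *m Q = (P^T *m U) *m (Q^T *m V)^T.
  by rewrite trmx_mul trmxK !mulmxA.
rewrite mxtrace_mul_tr_col; apply: ler_sum => i _.
rewrite (le_trans (ler_norm _)) // -sqrtr_sqr -sqrtrM ?frob2_ge0 //.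
rewrite ler_wsqrtr // (le_trans (frob2_cauchy_schwarz _ _)) //.
by rewrite !colE -!mulmxA ler_pM ?frob2_ge0 ?frob2_orthonormal_tr_mul_le.
Qed.

Lemma svalsP (R : realType) m n (W : 'M[R]_(m, n)) : is_svd W (svals W).
Proof. by apply: epsilon_spec; exact: svd_exists. Qed.

Lemma nucnorm_ge0 (R : realType) m n (W : 'M[R]_(m, n)) : 0 <= nucnorm W.
Proof. by have [P [Q [_ [_ [s0 _]]]]] := svalsP W; exact: sumr_ge0. Qed.

Lemma mxtrace_svd (R : realType) m n k (P : 'M[R]_(m, k)) (Q : 'M[R]_(n, k))
    (s : 'rV[R]_k) :
  P^T *m P = 1%:M -> Q^T *m Q = 1%:M ->
  \tr (P^T *m (P *m diag_mx s *m Q^T) *m Q) = \sum_i s 0 i.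
Proof.
by move=> PP QQ; rewrite -!mulmxA QQ mulmx1 mulmxA PP mul1mx mxtrace_diag.
Qed.

Lemma nucnorm_trace (R : realType) m n (W : 'M[R]_(m, n)) :
  exists (P : 'M[R]_(m, minn m n)) (Q : 'M[R]_(n, minn m n)),
    [/\ P^T *m P = 1%:M, Q^T *m Q = 1%:M & nucnorm W = \tr (P^T *m W *m Q)].
Proof.
have [P [Q [PP [QQ [s0 WE]]]]] := svalsP W.
by exists P, Q; split => //; rewrite [in RHS]WE mxtrace_svd.
Qed.

Lemma nucnorm_factor_le (R : realType) m n l (U : 'M[R]_(m, l))
    (V : 'M[R]_(n, l)) :
  nucnorm (U *m V^T) <=
  \sum_i Num.sqrt (frob2 (col i U)) * Num.sqrt (frob2 (col i V)).
Proof.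
by have [P [Q [PP QQ ->]]] := nucnorm_trace (U *m V^T); exact: mxtrace_factor_le.
Qed.

Lemma frob2_col (R : realType) m k (U : 'M[R]_(m, k)) i :
  frob2 (col i U) = (U^T *m U) i i.
Proof.
by rewrite /frob2 mxE; apply: eq_bigr => p _; rewrite big_ord1 !mxE expr2.
Qed.

Lemma svd_col_norms (R : realType) m n k (P : 'M[R]_(m, k)) (Q : 'M[R]_(n, k))
    (s : 'rV[R]_k) :
  P^T *m P = 1%:M -> Q^T *m Q = 1%:M -> (forall i, 0 <= s 0 i) ->
  \sum_i Num.sqrt (frob2 (col i (P *m diag_mx s))) * Num.sqrt (frob2 (col i Q))
  = \sum_i s 0 i.
Proof.
move=> PP QQ s0; apply: eq_bigr => i _; rewrite !frob2_col QQ.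
rewrite [1%:M i i]mxE eqxx sqrtr1 mulr1 trmx_mul tr_diag_mx -mulmxA [P^T *m _]mulmxA PP mul1mx.
by rewrite mulmx_diag !mxE eqxx mulr1n -expr2 sqrtr_sqr ger0_norm.
Qed.

Lemma mxtrace_le_nucnorm (R : realType) m n k (W : 'M[R]_(m, n))
    (P : 'M[R]_(m, k)) (Q : 'M[R]_(n, k)) :
  P^T *m P = 1%:M -> Q^T *m Q = 1%:M -> \tr (P^T *m W *m Q) <= nucnorm W.
Proof.
move=> PP QQ; have [P' [Q' [PP' [QQ' [s0 WE]]]]] := svalsP W.
by rewrite {1}WE /nucnorm -(svd_col_norms PP' QQ' s0) mxtrace_factor_le.
Qed.

(** [svals] is an arbitrary choice, so independence of the SVD needs proof: the sum of [s] is at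
    once a factorization bound, from above, and the value of a trace, from below. *)
Lemma nucnorm_svd (R : realType) m n (W : 'M[R]_(m, n)) s :
  is_svd W s -> nucnorm W = \sum_i s 0 i.
Proof.
move=> [P [Q [PP [QQ [s0 WE]]]]]; apply/le_anti/andP; split.
  by rewrite WE -(svd_col_norms PP QQ s0) nucnorm_factor_le.
by rewrite -(mxtrace_svd s PP QQ) -WE mxtrace_le_nucnorm.
Qed.

Lemma nucnorm_midpoint_le (R : realType) m n (A B : 'M[R]_(m, n)) :
  nucnorm (2^-1 *: (A + B)) <= (nucnorm A + nucnorm B) / 2.
Proof.
have [P [Q [PP QQ ->]]] := nucnorm_trace (2^-1 *: (A + B)).
rewrite -scalemxAr -scalemxAl mxtraceZ mulmxDr mulmxDl mxtraceD mulrC.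
by rewrite ler_pM2r ?invr_gt0 // lerD // mxtrace_le_nucnorm.
Qed.

(** Strict convexity tested at the midpoint: the nuclear term is at most its average, while by the
    parallelogram law the Frobenius term lies below its average by [frob2 (W1 - W2) / 16]. *)
Lemma Phi_minimizer_unique (R : realType) m n (M W1 W2 : 'M[R]_(m, n)) :
  (forall W, Phi M W1 <= Phi M W) -> Phi M W2 <= Phi M W1 -> W1 = W2.
Proof.
move=> min1 min2; apply/eqP; rewrite -subr_eq0 -frob2_eq0.
apply/eqP/le_anti; rewrite frob2_ge0 andbT.
have := min1 (2^-1 *: (W1 + W2)); move: min2; rewrite /Phi.
have := frob2_parallelogram (W1 - 2%:R *: M) (W2 - 2%:R *: M).
have -> : W1 - 2%:R *: M - (W2 - 2%:R *: M) = W1 - W2.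
  by rewrite opprB addrA subrK.
have -> : W1 - 2%:R *: M + (W2 - 2%:R *: M) =
          2 *: (2^-1 *: (W1 + W2) - 2%:R *: M).
  have h : 2 / 2 = 1 :> R by field.
  rewrite scalerBr !scalerA h scale1r addrACA -opprD -scalerDl.
  by congr (_ - _ *: _); ring.
rewrite frob2Z => par.
(* This also covers [minn m n = 0], where the inverse is 0. *)
have c0 : 0 <= (4 * (minn m n)%:R)^-1 :> R by rewrite invr_ge0 mulr_ge0.
move: (_^-1) c0 => c c0.
have : nucnorm (2^-1 *: (W1 + W2)) ^+ 2 <=
       (nucnorm W1 ^+ 2 + nucnorm W2 ^+ 2) / 2.
  have := nucnorm_midpoint_le W1 W2.
  have := nucnorm_ge0 (2^-1 *: (W1 + W2)).
  move: (nucnorm _) (nucnorm W1) (nucnorm W2) => x y z x0 xyz.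
  have := ler_pM x0 x0 xyz xyz; have := sqr_ge0 (y - z); lra.
move=> /(ler_wpM2r c0); move: (nucnorm _) (nucnorm W1) (nucnorm W2) => x y z.
lra.
Qed.

(** * Symmetric matrices with constant diagonal *)

(** Reflection in the hyperplane orthogonal to [a - b]. That it fixes this hyperplane pointwise is
    what later preserves the other diagonal entries. *)
Lemma householder (R : realType) k (a b : 'cV[R]_k) :
  frob2 a = 1 -> frob2 b = 1 ->
  exists H : 'M[R]_k,
    [/\ H^T = H, H *m H = 1%:M, H *m a = b &
        forall y : 'cV[R]_k, (a - b)^T *m y = 0 -> H *m y = y].
Proof.
move=> na nb; have [->|ab] := eqVneq a b.
  by exists 1%:M; split; rewrite ?trmx1 ?mul1mx // => y _; rewrite mul1mx.
pose w := a - b; pose c := frob2 w.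
have c0 : c != 0 by rewrite frob2_eq0 subr_eq0.
have ww : w^T *m w = c%:M by rewrite mul_tr_col.
have wa : w^T *m a = (c / 2)%:M.
  rewrite [LHS]mx11_scalar -trace_mx11 mxtrace_mulC mxtrace_mul_trC.
  rewrite /c /w frob2B na nb mulmxBl linearB /= -frob2E na.
  by rewrite (mxtrace_mul_trC b a); congr (_%:M); field.
exists (1%:M - (2 / c) *: (w *m w^T)); split.
- by rewrite linearB linearZ /= trmx1 trmx_mul trmxK.
- rewrite mulmxBl mul1mx mulmxBr mulmx1 -scalemxAl -scalemxAr.
  rewrite !mulmxA -(mulmxA w) ww mul_mx_scalar -scalemxAl !scalerA.
  rewrite -scalerBl -addrA -opprD -scalerDl.
  have -> : 2 / c + (2 / c - 2 / c * (2 / c * c)) = 0 by field.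
  by rewrite scale0r subr0.
- rewrite mulmxBl mul1mx -scalemxAl -mulmxA wa mul_mx_scalar scalerA.
  have -> : 2 / c * (c / 2) = 1 by field.
  by rewrite scale1r /w opprB addrC subrK.
- move=> y wy; rewrite mulmxBl mul1mx -scalemxAl -mulmxA wy mulmx0 scaler0.
  by rewrite subr0.
Qed.

Lemma mx_entryE (R : realType) k (A : 'M[R]_k) i j :
  A i j = (delta_mx 0 i *m A *m delta_mx j 0 : 'M_1) 0 0.
Proof. by rewrite -rowE -colE !mxE. Qed.

(* One reflection in the plane of coordinates i and j with A i i < 0 < A j j
   moves e_i to an isotropic vector of A. *)
Lemma sym_trace0_zero_diag (R : realType) k (A : 'M[R]_k) :
  A^T = A -> \tr A = 0 ->
  exists O : 'M[R]_k, O^T *m O = 1%:M /\ forall i, (O^T *m A *m O) i i = 0.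
Proof.
have [N] := ubnP #|[set i | A i i != 0]|; elim: N A => // N IH A ltN symA trA.
have [A0|] := altP (@forallP _ (fun i => A i i == 0)).
  exists 1%:M; rewrite trmx1 mulmx1; split => // i.
  by rewrite mul1mx mulmx1; apply/eqP.
rewrite negb_forall => /existsP[i0 Ai0].
have [i Ai] : exists i, A i i < 0.
  apply/existsP; apply: contraNT Ai0; rewrite negb_exists => /forallP ge.
  have /eqP := trA; rewrite psumr_eq0 => [|i _]; last by rewrite leNgt.
  by move=> /allP/(_ i0 (mem_index_enum _)).
have [j Aj] : exists j, 0 < A j j.
  apply/existsP; apply: contraNT Ai0; rewrite negb_exists => /forallP le.
  have /eqP := trA; rewrite -oppr_eq0 -sumrN psumr_eq0 => [|l _]; last first.
    by rewrite oppr_ge0 leNgt.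
  by move=> /allP/(_ i0 (mem_index_enum _)); rewrite /= oppr_eq0.
have ij : i != j by apply: contraTneq Aj => <-; rewrite -leNgt ltW.
(* A quarter of the discriminant of the quadratic form on [e_i + x e_j]; the opposite signs of
   [A i i] and [A j j] make it nonnegative, so a real root [x] exists. *)
pose D := A i j ^+ 2 - A i i * A j j.
have D0 : 0 <= D by rewrite /D; nra.
pose x := (Num.sqrt D - A i j) / A j j.
have xq : A i i + 2 * x * A i j + x ^+ 2 * A j j = 0.
  have := sqr_sqrtr D0; rewrite /x; move: (Num.sqrt D) => r rD.
  have -> : A i i + 2 * ((r - A i j) / A j j) * A i j +
     ((r - A i j) / A j j) ^+ 2 * A j j = (r ^+ 2 - D) / A j j.
    by rewrite /D; field; rewrite gt_eqF.
  by rewrite rD subrr mul0r.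
pose g : 'cV[R]_k := delta_mx i 0 + x *: delta_mx j 0.
have dd (p q : 'I_k) : (delta_mx 0 p : 'rV[R]_k) *m delta_mx q 0 = (p == q)%:R%:M.
  apply/matrixP => u v; rewrite !ord1 -rowE !mxE eqxx andbT mulr1n.
  by [].
have nd (p : 'I_k) : frob2 (delta_mx p 0 : 'cV[R]_k) = 1.
  by rewrite frob2E mxtrace_mulC trmx_delta dd eqxx trace_mx11 mxE.
have gT : g^T = delta_mx 0 i + x *: delta_mx 0 j.
  by rewrite /g linearD linearZ /= !trmx_delta.
have gAg : g^T *m A *m g = 0.
  rewrite [LHS]mx11_scalar (_ : _ 0 0 = 0) ?raddf0 //.
  rewrite gT /g !mulmxDl !mulmxDr -!scalemxAl.
  rewrite -!scalemxAr scalerA.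
  have E p q : (delta_mx 0 p *m A *m delta_mx q 0 : 'M_1) = (A p q)%:M.
    by rewrite [LHS]mx11_scalar -mx_entryE.
  rewrite !E !mxE eqxx !mulr1n -[in A j i]symA mxE -[RHS]xq; ring.
have g0 : g != 0.
  apply/eqP => /matrixP/(_ i 0); rewrite !mxE !eqxx (negPf ij) mulr0 addr0.
  by move/eqP; rewrite oner_eq0.
have [c c0 nc] : exists2 c : R, c != 0 & frob2 (c *: g) = 1.
  have [|c c0 nc] := @normalize_row _ _ g^T; first by rewrite trmx_eq0.
  by exists c => //; rewrite -frob2_tr linearZ.
have [H [symH HH Hi Hl]] := householder (nd i) nc.
have cgT : (c *: g)^T = c *: g^T by rewrite linearZ.
have dg i' : (H *m A *m H) i' i' =
    ((H *m delta_mx i' 0)^T *m A *m (H *m delta_mx i' 0) : 'M_1) 0 0.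
  by rewrite [LHS]mx_entryE trmx_mul symH trmx_delta !mulmxA.
have [|||O [OO Od]] := IH (H *m A *m H).
(* The count of nonzero diagonal entries drops: entry [i] becomes 0, entry [j] was already counted,
   and the reflection fixes every other basis vector. *)
- rewrite -ltnS (leq_trans _ ltN) // ltnS; apply: proper_card; apply/properP.
  split; last first.
    exists i; first by rewrite inE lt_eqF.
    rewrite inE negbK dg Hi cgT -!scalemxAl.
    by rewrite -scalemxAr gAg !scaler0 mxE.
  apply/subsetP => l; rewrite !inE dg.
  have [->|lj] := eqVneq l j; first by rewrite (gt_eqF Aj).
  have [->|li] := eqVneq l i; first by rewrite (lt_eqF Ai).
  rewrite Hl; first by rewrite trmx_delta -mx_entryE.
  rewrite linearB /= cgT gT trmx_delta mulmxBl -scalemxAl.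
  rewrite mulmxDl -scalemxAl !dd ![_ == l]eq_sym (negPf li) (negPf lj).
  by rewrite raddf0 !scaler0 addr0 scaler0 subrr.
- by rewrite !trmx_mul symH symA mulmxA.
- by rewrite -mulmxA mxtrace_mulC -mulmxA HH mulmx1.
exists (H *m O); split.
  by rewrite trmx_mul symH -mulmxA (mulmxA H) HH mul1mx.
by move=> l; have := Od l; rewrite trmx_mul symH !mulmxA.
Qed.

(** Subtracting the mean of the diagonal reduces to trace 0, since scalar matrices are invariant
    under rotation. *)
Lemma sym_constant_diag (R : realType) k (A : 'M[R]_k) :
  A^T = A ->
  exists O : 'M[R]_k,
    O^T *m O = 1%:M /\ forall i, (O^T *m A *m O) i i = \tr A / k%:R.
Proof.
case: k A => [|k] A symA.
  by exists 1%:M; rewrite trmx1 mulmx1; split => // -[].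
pose t : R := \tr A / k.+1%:R.
have [||O [OO Od]] := @sym_trace0_zero_diag _ _ (A - t%:M).
- by rewrite linearB /= symA tr_scalar_mx.
- by rewrite linearB /= mxtrace_scalar -mulr_natr divfK ?subrr // pnatr_eq0.
exists O; split => // i; have := Od i.
rewrite mulmxBr mulmxBl mul_mx_scalar -scalemxAl OO !mxE eqxx mulr1.
by move/eqP; rewrite subr_eq0 => /eqP.
Qed.

(** * The averaged loss *)

(** Symmetric difference with the singleton of [i]: it flips exactly one sign, so it pairs off the
    terms of an odd sum. *)
Definition toggle k (i : 'I_k) (S : {set 'I_k}) : {set 'I_k} :=
  [set l | (l \in S) (+) (l == i)].

Lemma toggleK k (i : 'I_k) : involutive (toggle i).
Proof. by move=> S; apply/setP => l; rewrite !inE -addbA addbb addbF. Qed.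

Lemma sum_toggle_odd (R : realType) k (i : 'I_k) (F : {set 'I_k} -> R) :
  (forall S, F (toggle i S) = - F S) -> \sum_S F S = 0.
Proof.
move=> Fi; have : \sum_S F S = - \sum_S F S.
  rewrite [LHS](reindex_inj (inv_inj (toggleK i))) /= -sumrN.
  by apply: eq_bigr => S _; exact: Fi.
by lra.
Qed.

(* The variance of a sum of independent Bernoulli(1/2) terms, written with the
   signs 2 [i \in S] - 1, which are orthogonal on the set of all S. *)
Lemma sum_sets_sqr (R : realType) k (a : 'I_k -> R) (c : R) :
  \sum_(S : {set 'I_k}) (\sum_i (if i \in S then a i else 0) - c) ^+ 2 =
  2 ^+ k * (((\sum_i a i) / 2 - c) ^+ 2 + (\sum_i a i ^+ 2) / 4).
Proof.
pose e (S : {set 'I_k}) i : R := if i \in S then 1 else -1.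
have eS S i : e (toggle i S) i = - e S i.
  by rewrite /e inE eqxx addbT; case: (i \in S) => /=; rewrite ?opprK.
have eS' S i j : j != i -> e (toggle i S) j = e S j.
  by move=> ji; rewrite /e inE (negPf ji) addbF.
have e1 i : \sum_S e S i = 0 by apply: (@sum_toggle_odd _ _ i) => S; exact: eS.
have e2 i j : i != j -> \sum_S e S i * e S j = 0.
  move=> ij; apply: (@sum_toggle_odd _ _ i) => S.
  by rewrite eS eS' 1?eq_sym // mulNr.
have ee S i : e S i * e S i = 1.
  by rewrite /e; case: (i \in S); rewrite ?mulr1 // mulrNN mulr1.
have cS : \sum_(S : {set 'I_k}) (1 : R) = 2 ^+ k.
  by rewrite sumr_const -cardsT -powersetT card_powerset cardsT card_ord natrX.
pose D := (\sum_i a i) / 2 - c.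
(* Since the indicator of [i \in S] is [(1 + e S i) / 2], each summand is the square of
   [D + (\sum_i e S i * a i) / 2]. Summed over [S], the linear part vanishes and only the diagonal
   of the quadratic part survives. *)
transitivity (\sum_(S : {set 'I_k}) (D ^+ 2 + (D * \sum_i e S i * a i +
    (\sum_i \sum_j (e S i * e S j) * (a i * a j)) / 4))).
  apply: eq_bigr => S _.
  have -> : \sum_i (if i \in S then a i else 0) =
      (\sum_i a i) / 2 + (\sum_i e S i * a i) / 2.
    rewrite -mulrDl -big_split mulr_suml; apply: eq_bigr => i _ /=.
    by rewrite /e; case: (i \in S); field.
  have -> : \sum_i \sum_j (e S i * e S j) * (a i * a j) =
      (\sum_i e S i * a i) ^+ 2.
    rewrite expr2 mulr_suml; apply: eq_bigr => i _; rewrite mulr_sumr.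
    by apply: eq_bigr => j _; rewrite mulrACA.
  by rewrite /D; field.
rewrite !big_split /=.
have -> : \sum_(S : {set 'I_k}) D ^+ 2 = 2 ^+ k * D ^+ 2.
  by rewrite -cS mulr_suml; apply: eq_bigr => S _; rewrite mul1r.
have -> : \sum_(S : {set 'I_k}) D * (\sum_i e S i * a i) = 0.
  rewrite -mulr_sumr exchange_big /= big1 ?mulr0 // => i _.
  by rewrite /= -mulr_suml e1 mul0r.
rewrite -mulr_suml exchange_big /= add0r mulrDr mulrA; congr (_ + _ / _).
rewrite mulr_sumr; apply: eq_bigr => i _; rewrite exchange_big /= (bigD1 i) //=.
rewrite [X in _ + X]big1 ?addr0 => [|j ji]; last by rewrite -mulr_suml e2 1?eq_sym // mul0r.
rewrite -mulr_suml -cS expr2; congr (_ * _).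
by apply: eq_bigr => S _; exact: ee.
Qed.

(** The added [frob2 M] is the missing term of the empty set. The sum then runs over all [S], and
    the variance identity applies to each entry of the matrix. *)
Lemma Lk_expand (R : realType) m n (M : 'M[R]_(m, n))
    (U : 'M[R]_(m, minn m n)) (V : 'M[R]_(n, minn m n)) :
  (0 < minn m n)%N ->
  Lk M U V * (2 ^+ minn m n - 1) + frob2 M =
  2 ^+ minn m n * (frob2 (U *m V^T - 2%:R *: M) / 4 +
    (\sum_i frob2 (col i U) * frob2 (col i V)) / 4).
Proof.
move=> k0; rewrite /Lk divfK; last first.
  by rewrite gt_eqF // subr_gt0 exprn_egt1 ?ltr1n // -lt0n.
have -> : frob2 M = frob2 (U *m PiS R set0 *m V^T - M).
  have -> : PiS R (set0 : {set 'I_(minn m n)}) = 0.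
    by apply/matrixP => i j; rewrite !mxE inE mul0rn.
  by rewrite mulmx0 mul0mx sub0r -scaleN1r frob2Z sqrrN expr1n mul1r.
transitivity (\sum_S frob2 (U *m PiS R S *m V^T - M)).
  by rewrite [RHS](bigD1 set0) //= addrC.
have entry S p q : (U *m PiS R S *m V^T - M) p q =
    \sum_i (if i \in S then U p i * V q i else 0) - M p q.
  rewrite !mxE; congr (_ - _); apply: eq_bigr => i _.
  rewrite mul_mx_diag !mxE; case: (i \in S); rewrite ?mulr1 //.
  by rewrite mulr0 mul0r.
rewrite /frob2 exchange_big /=.
transitivity (\sum_p \sum_q 2 ^+ minn m n *
   (((\sum_i U p i * V q i) / 2 - M p q) ^+ 2 +
    (\sum_i (U p i * V q i) ^+ 2) / 4)).
  apply: eq_bigr => p _; rewrite exchange_big /=; apply: eq_bigr => q _.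
  by rewrite -sum_sets_sqr; apply: eq_bigr => S _; rewrite entry.
transitivity (\sum_p 2 ^+ minn m n *
   (\sum_q ((\sum_i U p i * V q i) / 2 - M p q) ^+ 2 +
    (\sum_q \sum_i (U p i * V q i) ^+ 2) / 4)).
  by apply: eq_bigr => p _; rewrite -mulr_sumr big_split /= -mulr_suml.
rewrite -mulr_sumr big_split /= -mulr_suml; congr (_ * (_ + _ / _)).
  rewrite mulr_suml; apply: eq_bigr => p _; rewrite mulr_suml.
  apply: eq_bigr => q _; rewrite !mxE.
  under [in RHS]eq_bigr do rewrite mxE.
  by field.
transitivity (\sum_p \sum_i \sum_q (U p i * V q i) ^+ 2).
  by apply: eq_bigr => p _; exact: exchange_big.
rewrite exchange_big /=; apply: eq_bigr => i _.
rewrite mulr_suml; apply: eq_bigr => p _; rewrite big_ord1 mulr_sumr.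
by apply: eq_bigr => q _; rewrite big_ord1 !mxE exprMn.
Qed.

Lemma sqr_sum_le (R : realType) k (x : 'I_k -> R) :
  (\sum_i x i) ^+ 2 <= k%:R * \sum_i x i ^+ 2.
Proof.
have := frob2_cauchy_schwarz (\row_i x i) (const_mx 1).
rewrite trace_mx11 mxE /frob2 !big_ord1.
under eq_bigr do rewrite !mxE mulr1.
under [X in _ <= X * _ -> _]eq_bigr do rewrite mxE.
under [X in _ <= _ * X -> _]eq_bigr do rewrite mxE expr1n.
by rewrite sumr_const card_ord mulrC.
Qed.

(** The factorization bound, followed by Cauchy-Schwarz against the all-ones vector. *)
Lemma nucnorm_sqr_factor_le (R : realType) m n l (U : 'M[R]_(m, l))
    (V : 'M[R]_(n, l)) :
  nucnorm (U *m V^T) ^+ 2 <= l%:R * \sum_i frob2 (col i U) * frob2 (col i V).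
Proof.
apply: (@le_trans _ _
  ((\sum_i Num.sqrt (frob2 (col i U)) * Num.sqrt (frob2 (col i V))) ^+ 2)).
  rewrite ler_sqr ?nnegrE ?nucnorm_ge0 ?nucnorm_factor_le //.
  by apply: sumr_ge0 => i _; rewrite mulr_ge0 ?sqrtr_ge0.
apply: le_trans (sqr_sum_le _) _.
under eq_bigr do rewrite exprMn !sqr_sqrtr ?frob2_ge0 //.
exact: lexx.
Qed.

(* Rotating the balanced factors P s^(1/2), Q s^(1/2) so that O^T s O has
   constant diagonal gives all columns the same norm, which is the equality
   case of the previous lemma. *)
Lemma nucnorm_factor_attained (R : realType) m n (W : 'M[R]_(m, n)) :
  exists (U : 'M[R]_(m, minn m n)) (V : 'M[R]_(n, minn m n)),
    U *m V^T = W /\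
    \sum_i frob2 (col i U) * frob2 (col i V) = nucnorm W ^+ 2 / (minn m n)%:R.
Proof.
have [P [Q [PP [QQ [s0 WE]]]]] := svalsP W.
set s := svals W in s0 WE.
have [O [OO Od]] := @sym_constant_diag _ _ (diag_mx s) (tr_diag_mx s).
have OOt : O *m O^T = 1%:M by exact: mulmx1C.
pose r := diag_mx (\row_i Num.sqrt (s 0 i)).
have rr : r *m r = diag_mx s.
  rewrite mulmx_diag; congr diag_mx; apply/rowP => i.
  by rewrite !mxE -expr2 sqr_sqrtr.
have rT : r^T = r by rewrite tr_diag_mx.
have cols p (X : 'M[R]_(p, minn m n)) i : X^T *m X = 1%:M ->
    frob2 (col i (X *m r *m O)) = nucnorm W / (minn m n)%:R.
  move=> XX; rewrite frob2_col !trmx_mul rT -!mulmxA (mulmxA X^T) XX mul1mx.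
  by rewrite (mulmxA r) rr mulmxA Od mxtrace_diag.
exists (P *m r *m O), (Q *m r *m O); split.
  rewrite !trmx_mul rT -!mulmxA (mulmxA O) OOt mul1mx (mulmxA r) rr.
  by rewrite mulmxA -WE.
under eq_bigr do rewrite !cols //.
rewrite sumr_const card_ord -[LHS]mulr_natr.
(* In dimension 0 both sides vanish because division by 0 gives 0. *)
have [->|k0] := eqVneq ((minn m n)%:R : R) 0; first by rewrite invr0 !mulr0.
by field.
Qed.

(** * Minimizers of Phi *)

Lemma frob2_svd (R : realType) m n k (P : 'M[R]_(m, k)) (Q : 'M[R]_(n, k))
    (s : 'rV[R]_k) :
  P^T *m P = 1%:M -> Q^T *m Q = 1%:M ->
  frob2 (P *m diag_mx s *m Q^T) = \sum_i s 0 i ^+ 2.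
Proof.
move=> PP QQ; rewrite -mulmxA frob2_orthonormal_mul // -frob2_tr trmx_mul trmxK.
rewrite frob2_orthonormal_mul // frob2_tr frob2E tr_diag_mx mulmx_diag.
by rewrite mxtrace_diag; apply: eq_bigr => i _; rewrite mxE expr2.
Qed.

(** For competitors sharing the singular vectors of the target, [Phi] becomes a function of vectors;
    [w] must be nonnegative to be read as singular values. *)
Lemma Phi_svd (R : realType) m n (P : 'M[R]_(m, minn m n))
    (Q : 'M[R]_(n, minn m n)) (s w : 'rV[R]_(minn m n)) :
  P^T *m P = 1%:M -> Q^T *m Q = 1%:M -> (forall i, 0 <= w 0 i) ->
  Phi (P *m diag_mx s *m Q^T) (P *m diag_mx w *m Q^T) =
  (\sum_i (w 0 i - 2 * s 0 i) ^+ 2) / 4 +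
  (\sum_i w 0 i) ^+ 2 / (4 * (minn m n)%:R).
Proof.
move=> PP QQ w0; rewrite /Phi (@nucnorm_svd _ _ _ _ w); last by exists P, Q.
congr (_ / _ + _).
have -> : P *m diag_mx w *m Q^T - 2%:R *: (P *m diag_mx s *m Q^T) =
          P *m diag_mx (w - 2%:R *: s) *m Q^T.
  have -> : diag_mx (w - 2%:R *: s) = diag_mx w - 2%:R *: diag_mx s.
    by rewrite linearB linearZ.
  by rewrite mulmxBr mulmxBl -scalemxAr -scalemxAl.
by rewrite frob2_svd //; apply: eq_bigr => i _; rewrite !mxE.
Qed.

(* Shifting a small mass from sigma_j to a larger sigma_i keeps the nuclear norm
   and decreases the distance to 2 M. *)
Lemma Phi_minimizer_eq_singular_values (R : realType) m n
    (P : 'M[R]_(m, minn m n)) (Q : 'M[R]_(n, minn m n))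
    (s : 'rV[R]_(minn m n)) :
  P^T *m P = 1%:M -> Q^T *m Q = 1%:M -> (forall i, 0 < s 0 i) ->
  (forall W, Phi (P *m diag_mx s *m Q^T) (P *m diag_mx s *m Q^T) <=
             Phi (P *m diag_mx s *m Q^T) W) ->
  forall i j, s 0 i = s 0 j.
Proof.
move=> PP QQ s0 min.
suff H i j : ~~ (s 0 j < s 0 i) by move=> i j; apply/le_anti; rewrite !leNgt !H.
apply/negP => ji.
have ij : i != j by apply: contraTneq ji => ->; rewrite ltxx.
(* The first bound keeps entry [j] nonnegative after the shift, the second makes the decrease
   strict. *)
have [e e0 [ej es]] : exists2 e : R, 0 < e & e <= s 0 j /\ e < s 0 i - s 0 j.
  exists (Num.min (s 0 j) ((s 0 i - s 0 j) / 2)).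
    by rewrite lt_min s0 /= divr_gt0 // subr_gt0.
  split; first by rewrite ge_min lexx.
  by rewrite gt_min; apply/orP; right; lra.
pose d : 'rV[R]_(minn m n) := delta_mx 0 i - delta_mx 0 j.
have di : d 0 i = 1 by rewrite !mxE !eqxx (negPf ij) subr0.
have dj : d 0 j = -1 by rewrite !mxE !eqxx eq_sym (negPf ij) sub0r.
have dl l : l != i -> l != j -> d 0 l = 0.
  by move=> li lj; rewrite !mxE !eqxx (negPf li) (negPf lj) subr0.
have sumd (F : 'I_(minn m n) -> R -> R) :
    (forall l, F l 0 = 0) -> \sum_l F l (d 0 l) = F i 1 + F j (-1).
  move=> F0; rewrite (bigD1 i) //= (bigD1 j) 1?eq_sym //= di dj big1 ?addr0 //.
  by move=> l /andP[li lj]; rewrite dl.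
have wE l : (s + e *: d) 0 l = s 0 l + e * d 0 l.
  by rewrite mxE [X in _ + X]mxE.
have w0 l : 0 <= (s + e *: d) 0 l.
  rewrite wE.
  have [->|li] := eqVneq l i; first by rewrite di; have := s0 i; lra.
  have [->|lj] := eqVneq l j; first by rewrite dj; lra.
  by rewrite dl // mulr0 addr0 ltW.
have := min (P *m diag_mx (s + e *: d) *m Q^T).
rewrite !Phi_svd // => [|l]; last exact: ltW.
have -> : \sum_l (s + e *: d) 0 l = \sum_l s 0 l.
  under eq_bigr do rewrite wE.
  rewrite big_split /= (sumd (fun _ x => e * x)) => [|l]; last by rewrite mulr0.
  by ring.
have -> : \sum_l ((s + e *: d) 0 l - 2 * s 0 l) ^+ 2 =
    \sum_l (s 0 l - 2 * s 0 l) ^+ 2 + (2 * e ^+ 2 - 2 * e * (s 0 i - s 0 j)).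
  transitivity (\sum_l ((s 0 l - 2 * s 0 l) ^+ 2 +
      (e ^+ 2 * d 0 l ^+ 2 - 2 * e * s 0 l * d 0 l))).
    by apply: eq_bigr => l _; rewrite wE; ring.
  rewrite big_split /=; congr (_ + _).
  rewrite (sumd (fun l x => e ^+ 2 * x ^+ 2 - 2 * e * s 0 l * x)) => [|l]; ring.
rewrite lerD2r ler_pM2r ?invr_gt0 // lerDl.
have : e * e < e * (s 0 i - s 0 j) by rewrite ltr_pM2l.
lra.
Qed.

(* P Q^T is a subgradient of the nuclear norm at c P Q^T. *)
Lemma Phi_scaled_isometry_minimizer (R : realType) m n
    (P : 'M[R]_(m, minn m n)) (Q : 'M[R]_(n, minn m n)) (c : R)
    (W : 'M[R]_(m, n)) :
  (0 < minn m n)%N -> P^T *m P = 1%:M -> Q^T *m Q = 1%:M -> 0 <= c ->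
  Phi (c *: (P *m Q^T)) W <= Phi (c *: (P *m Q^T)) (c *: (P *m Q^T)) ->
  W = c *: (P *m Q^T).
Proof.
move=> k0 PP QQ c0; set M := c *: _.
have k0' : 0 < (minn m n)%:R :> R by rewrite ltr0n.
have MS : M = P *m diag_mx (const_mx c) *m Q^T.
  by rewrite diag_const_mx mul_mx_scalar -scalemxAl.
have nM : nucnorm M = (minn m n)%:R * c.
  rewrite (@nucnorm_svd _ _ _ _ (const_mx c)).
    under eq_bigr do rewrite mxE.
    by rewrite sumr_const card_ord mulr_natl.
  by exists P, Q; do 3!split => //; move=> i; rewrite mxE.
have fM : frob2 M = (minn m n)%:R * c ^+ 2.
  rewrite MS frob2_svd //; under eq_bigr do rewrite mxE.
  by rewrite sumr_const card_ord mulr_natl.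
(* The subgradient inequality, in the form of trace duality against [P] and [Q]. *)
have nW : \tr (W *m M^T) <= c * nucnorm W.
  rewrite /M linearZ /= -scalemxAr mxtraceZ ler_wpM2l //.
  rewrite trmx_mul trmxK mulmxA mxtrace_mulC mulmxA.
  exact: mxtrace_le_nucnorm.
clearbody M; rewrite /Phi nM => le; apply/eqP; rewrite -subr_eq0 -frob2_eq0.
apply/eqP/le_anti; rewrite frob2_ge0 andbT.
move: le; rewrite !frob2B !frob2Z linearZ /= -!scalemxAr !mxtraceZ -frob2E fM.
move: (minn m n)%:R k0' (nucnorm W) (frob2 W) (\tr _) nW => k k0' x f t tx.
have -> : (k * c) ^+ 2 / (4 * k) = k * c ^+ 2 / 4.
  by field; rewrite gt_eqF.
(* The tangent line at [x = k * c], the nuclear norm of [M], lies below the parabola. With the trace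
   bound it gives [Phi M W - Phi M M >= frob2 (W - M) / 4]. *)
have : (2 * c * x - k * c ^+ 2) / 4 <= x ^+ 2 / (4 * k).
  rewrite -subr_ge0.
  have -> : x ^+ 2 / (4 * k) - (2 * c * x - k * c ^+ 2) / 4 =
      (x - k * c) ^+ 2 / (4 * k) by field; rewrite gt_eqF.
  by rewrite divr_ge0 ?sqr_ge0 // mulr_ge0 // ltW.
lra.
Qed.

(** The second part asks for at least two singular values: with a single one they all agree, so
    [Wst = M] and the strict inequality would fail. *)
Theorem theoremB7 (R : realType) (m n : nat) (M : 'M[R]_(m, n))
  (P : 'M[R]_(m, minn m n)) (Q : 'M[R]_(n, minn m n)) (sigma : 'rV[R]_(minn m n))
  (hP : P^T *m P = 1%:M) (hQ : Q^T *m Q = 1%:M)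
  (hM : M = P *m diag_mx sigma *m Q^T)
  (hdec : forall i j : 'I_(minn m n), (i < j)%N -> sigma 0 j < sigma 0 i)
  (hpos : forall i : 'I_(minn m n), 0 < sigma 0 i)
  (Wst : 'M[R]_(m, n))
  (hWst : forall W : 'M[R]_(m, n), Phi M Wst <= Phi M W) :
  (Wst = M <-> forall i j : 'I_(minn m n), sigma 0 i = sigma 0 j) /\
  ((1 < minn m n)%N ->
   forall (U : 'M[R]_(m, minn m n)) (V : 'M[R]_(n, minn m n)),
     (forall (U' : 'M[R]_(m, minn m n)) (V' : 'M[R]_(n, minn m n)),
        Lk M U V <= Lk M U' V') ->
     frob2 (U *m V^T - M) = frob2 (Wst - M) /\ 0 < frob2 (Wst - M)).
Proof.
have iffM : Wst = M <-> forall i j : 'I_(minn m n), sigma 0 i = sigma 0 j.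
  split=> [WM i j|sij].
    apply: (Phi_minimizer_eq_singular_values hP hQ hpos); rewrite -hM => W.
    by rewrite -{2}WM hWst.
  have [k0|k0] := posnP (minn m n).
    apply/matrixP => i j; exfalso.
    have : (0 < minn m n)%N.
      by rewrite leq_min (leq_ltn_trans _ (ltn_ord i)) // (leq_ltn_trans _ (ltn_ord j)).
    by rewrite k0.
  pose i0 := Ordinal k0.
  have ME : M = sigma 0 i0 *: (P *m Q^T).
    rewrite hM (_ : sigma = const_mx (sigma 0 i0)).
      by rewrite diag_const_mx mul_mx_scalar -scalemxAl mxE.
    by apply/rowP => i; rewrite mxE.
  have := hWst M; rewrite {}ME.
  exact: (Phi_scaled_isometry_minimizer k0 hP hQ (ltW (hpos i0))).
split=> // k1 U V minUV; have k0 : (0 < minn m n)%N by exact: ltnW.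
have k0' : 0 < (minn m n)%:R :> R by rewrite ltr0n.
suff <- : Wst = U *m V^T.
  split=> //; rewrite frob2_gt0 subr_eq0; apply/eqP => /iffM sij.
  have := hdec (Ordinal k0) (Ordinal k1) isT.
  by rewrite (sij (Ordinal k0) (Ordinal k1)) ltxx.
apply: (Phi_minimizer_unique hWst).
(* The balanced factorization of [Wst] is the competitor: up to one increasing affine map, [Phi] at
   [U *m V^T] is at most the loss at [(U, V)], which is at most the loss at [(U', V')], and that
   equals [Phi] at [Wst]. *)
have [U' [V' [UV' sUV']]] := nucnorm_factor_attained Wst.
have p2 : 1 < 2 ^+ minn m n :> R by rewrite exprn_egt1 ?ltr1n // -lt0n.
have : Lk M U V * (2 ^+ minn m n - 1) + frob2 M <=
       Lk M U' V' * (2 ^+ minn m n - 1) + frob2 M.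
  by rewrite lerD2r ler_pM2r ?minUV // subr_gt0.
rewrite !Lk_expand // UV' sUV' ler_pM2l; last exact: lt_trans p2.
have := nucnorm_sqr_factor_le U V.
rewrite -ler_pdivrMl // => le_nuc.
rewrite /Phi !invfM !mulrA.
move: le_nuc; rewrite [_^-1 * _]mulrC.
set a := nucnorm (U *m V^T) ^+ 2 / _; set b := nucnorm Wst ^+ 2 / _.
have kC x : x / 4 / (minn m n)%:R = x / (minn m n)%:R / 4 :> R.
  by rewrite mulrAC.
rewrite !kC -/a -/b; lra.
Qed.
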